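(* Let $\bar Z\in\mathbb{R}^{n_p\times n_p}$ satisfy the feasibility condition $$\bar Z^T\big[I+\tfrac12(D_u+D_u^T)\big]\bar Z-\tfrac12\bar Z^T-\tfrac12\bar Z\preceq 0,$$ and let the stationary performance with $Z_k=\bar Z$ for all $k$ be $\bar J$. Let $\mathcal{K}:x\mapsto Z$ be any causal feedback law for which $Z_k$ satisfies the feasibility condition $$Z_k^T\big[I+\tfrac12(D_u+D_u^T)\big]Z_k-\tfrac12 Z_k^T-\tfrac12 Z_k\preceq 0$$ for all $x_k\in\mathbb{R}^n$. Let $P=P^T\succeq 0$ be the unique solution to the Lyapunov equation $$0=[A-B_u\bar ZC_v]^TP[A-B_u\bar ZC_v]-P+C_y^TC_y .$$ Let $\bar\mu_x=[I-A+B_u\bar ZC_v]^{-1}[B_w-B_u\bar ZD_w]\mu_w$ and define $$L\triangleq[A-B_u\bar ZC_v-I]^{-T}C_y^T\,[y^\star-C_y\bar\mu_x],\qquad F\triangleq B_u^TP[A-B_u\bar ZC_v],\qquad R\triangleq B_u^TPB_u,$$ $$M\triangleq B_w-B_u\bar ZD_w,\qquad G\triangleq B_u^TPMS_wD_w^T,\qquad W\triangleq D_wS_wD_w^T,$$ and the signals $$m_k\triangleq x_k-\bar\mu_x,\qquad r_k\triangleq Fm_k+B_u^TL,\qquad q_k\triangleq C_vx_k+D_w\mu_w .$$ Then, in stationarity, the performance $J=\mathcal{E}\{\|y_k-y^\star\|_2^2\}$ of controller $\mathcal{K}$ is $$J=\bar J+\mathcal{E}\{\phi(x_k,Z_k)\},$$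 where $$\phi(x_k,Z_k)=q_k^T\Delta Z_k^TR\,\Delta Z_k\,q_k-2r_k^T\Delta Z_k\,q_k+\operatorname{tr}\!\big(W\Delta Z_k^TR\,\Delta Z_k-2G^T\Delta Z_k\big),$$ and where $\Delta Z_k\triangleq Z_k-\bar Z$.
   Context: Plant. Consider the discrete-time linear time-invariant system $$x_{k+1}=Ax_k+B_uu_k+B_ww_k,\qquad v_k=C_vx_k+D_uu_k+D_ww_k,\qquad y_k=C_yx_k,\qquad k\in\mathbb{Z},$$ with real matrices, state $x_k\in\mathbb{R}^n$, control input $u_k\in\mathbb{R}^{n_p}$, colocated output $v_k\in\mathbb{R}^{n_p}$, tracking output $y_k\in\mathbb{R}^{n_y}$, and exogenous stochastic disturbance $w_k\in\mathbb{R}^{n_w}$. The sequence $(w_k)$ is independent and identically distributed with mean $\mu_w\in\mathbb{R}^{n_w}$ and covariance matrix $S_w=S_w^T\succ0$. The mapping $u\mapsto v$ is assumed passive, and consequently the transfer function $H_{uv}(z)=D_u+C_v[zI-A]^{-1}B_u$ is positive-real. The vector $y^\star\in\mathbb{R}^{n_y}$ is a constant reference (desired set point). Control. The input is parametrized by a matrix $Z_k\in\mathbb{R}^{n_p\times n_p}$ as $u_k=-Z_k(C_vx_k+D_ww_k)$. This comes from a sector constraint $u_k=-\tilde Z_kv_k$ with $\tilde Z_k$ diagonal with entries in $[0,1]$, through the change of variable $Z_k=[I+\tilde Z_kD_u]^{-1}\tilde Z_k$, which implies the feasibility condition on $Z_k$ stated in the claim. The feedback law $\mathcal{K}$ determines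 $Z_k$ from the state causally, so that $w_k$ is independent of $x_k$ and $Z_k$. Notation. $\mathcal{E}\{\cdot\}$ denotes the stationary expectation; $\preceq,\succeq,\succ$ denote the order on symmetric matrices; $X^{-T}=(X^{-1})^T$. Static performance. With $Z_k=\bar Z$ for all $k$, the state in stationarity has mean $\bar\mu_x$ and covariance $\bar S_x$, the solution of $$\bar S_x=[A-B_u\bar ZC_v]\bar S_x[A-B_u\bar ZC_v]^T+[B_w-B_u\bar ZD_w]S_w[B_w-B_u\bar ZD_w]^T,$$ and $$\bar J=\operatorname{tr}\{C_y\bar S_xC_y^T\}+\|C_y\bar\mu_x-y^\star\|_2^2 .$$ *)

(* Defs.v *)
From HB Require Import structures.
From mathcomp Require Import all_boot all_order all_algebra.
From mathcomp Require Import all_classical all_reals all_analysis.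

Set Implicit Arguments.
Unset Strict Implicit.
Unset Printing Implicit Defensive.

Import Order.TTheory GRing.Theory Num.Theory.

Local Open Scope classical_set_scope.
Local Open Scope ring_scope.

(* [`|v|] on matrices is the sup norm in MathComp-Analysis, hence this one. *)
Definition sqnorm2 (R : realType) (m : nat) (v : 'cV[R]_m) : R :=
  \sum_i (v i 0) ^+ 2.

Definition psdmx (R : realType) (m : nat) (S : 'M[R]_m) : Prop :=
  S^T = S /\ forall v : 'cV[R]_m, 0 <= (v^T *m S *m v) 0 0.

Definition pdmx (R : realType) (m : nat) (S : 'M[R]_m) : Prop :=
  S^T = S /\ forall v : 'cV[R]_m, v != 0 -> 0 < (v^T *m S *m v) 0 0.

Definition loewner_le (R : realType) (m : nat) (X Y : 'M[R]_m) : Prop :=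
  psdmx (Y - X).

Definition feasible (R : realType) (np : nat) (Du Z : 'M[R]_np) : Prop :=
  loewner_le (Z^T *m (1%:M + 2^-1 *: (Du + Du^T)) *m Z
              - 2^-1 *: Z^T - 2^-1 *: Z) 0.

(* Input-output passivity of u |-> v: from rest and without disturbance, the
   supplied energy is nonnegative over every finite horizon.  Positive-realness
   of the transfer function is a consequence. *)
Definition passive (R : realType) (n np : nat) (A : 'M[R]_n)
    (Bu : 'M[R]_(n, np)) (Cv : 'M[R]_(np, n)) (Du : 'M[R]_np) : Prop :=
  forall (u : nat -> 'cV[R]_np) (x : nat -> 'cV[R]_n),
    x 0%N = 0 ->
    (forall k, x k.+1 = A *m x k + Bu *m u k) ->
    forall N : nat,
      0 <= \sum_(k < N) ((u k)^T *m (Cv *m x k + Du *m u k)) 0 0.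

(* The Borel sets of a matrix space, generated by the entries. *)
Definition borel_mx (R : realType) (m n : nat) : set (set 'M[R]_(m, n)) :=
  <<s \bigcup_(ij in [set: 'I_m * 'I_n])
        preimage_set_system setT (fun X : 'M[R]_(m, n) => X ij.1 ij.2)
          measurable >>.

Definition sigma_mx (R : realType) (T : Type) (m n : nat)
    (X : T -> 'M[R]_(m, n)) : set (set T) :=
  preimage_set_system setT X (@borel_mx R m n).

Definition indep_classes (R : realType) (d : measure_display)
    (T : measurableType d) (Pr : probability T R) (F G : set (set T)) : Prop :=
  forall A B, F A -> G B -> Pr (A `&` B) = (Pr A * Pr B)%E.

Definition square_integrable (R : realType) (d : measure_display)
    (T : measurableType d) (Pr : probability T R) (m : nat)
    (X : T -> 'cV[R]_m) : Prop :=
  forall i, (fun t => X t i 0) \in Lfun Pr 2%:E.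

(* The library's expectation and covariance are total functions, so square
   integrability has to be required for the mean and covariance conditions to
   be meaningful; it also makes every [w k] measurable. *)
Record iid_disturbance (R : realType) (d : measure_display)
    (T : measurableType d) (Pr : probability T R) (nw : nat)
    (w : int -> T -> 'cV[R]_nw) (muw : 'cV[R]_nw) (Sw : 'M[R]_nw) : Prop :=
  IidDisturbance {
    iid_square_integrable : forall k, square_integrable Pr (w k);
    iid_independent :
      forall (ks : seq int) (E : int -> set T), uniq ks ->
        (forall k, sigma_mx (w k) (E k)) ->
        Pr (\big[setI/setT]_(k <- ks) E k) = (\prod_(k <- ks) Pr (E k))%E;
    iid_identical :
      forall (k l : int) (B : set 'cV[R]_nw), borel_mx B ->
        Pr (w k @^-1` B) = Pr (w l @^-1` B);
    iid_mean : forall k i,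
      ('E_Pr[fun t => (w k t i 0)%R] = ((muw i 0)%R)%:E)%E;
    iid_covariance : forall k i j,
      covariance Pr (fun t => w k t i 0) (fun t => w k t j 0) = (Sw i j)%:E
  }.

(* Strict stationarity: shift-invariant finite-dimensional distributions. *)
Definition strictly_stationary (R : realType) (d : measure_display)
    (T : measurableType d) (Pr : probability T R) (n : nat)
    (x : int -> T -> 'cV[R]_n) : Prop :=
  forall (ks : seq int) (h : int) (B : int -> set 'cV[R]_n),
    (forall k, borel_mx (B k)) ->
    Pr (\big[setI/setT]_(k <- ks) (x (k + h) @^-1` B k))
      = Pr (\big[setI/setT]_(k <- ks) (x k @^-1` B k)).

(* A causal feedback law maps a state history, with entry j the state j steps
   ago, to a gain matrix; memoryless laws depend on entry 0 only. *)
Definition causal_law (R : realType) (n np : nat) : Type :=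
  (nat -> 'cV[R]_n) -> 'M[R]_np.

(* Measurability with respect to the product sigma-algebra on histories. *)
Definition measurable_law (R : realType) (n np : nat)
    (K : causal_law R n np) : Prop :=
  forall B : set 'M[R]_np, borel_mx B ->
    <<s \bigcup_(j in [set: nat])
          sigma_mx (fun h : nat -> 'cV[R]_n => h j) >> (K @^-1` B).

Definition gain (R : realType) (T : Type) (n np : nat) (K : causal_law R n np)
    (x : int -> T -> 'cV[R]_n) (k : int) (t : T) : 'M[R]_np :=
  K (fun j => x (k - j%:Z) t).

(* A stationary regime of the plant in closed loop with the law K.  Finiteness
   of the second moments of the state is part of the notion, so that stationary
   means, covariances and quadratic costs exist. *)
Record stationary_loop (R : realType) (d : measure_display)
    (T : measurableType d) (Pr : probability T R) (n np nw : nat)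
    (A : 'M[R]_n) (Bu : 'M[R]_(n, np)) (Bw : 'M[R]_(n, nw))
    (Cv : 'M[R]_(np, n)) (Dw : 'M[R]_(np, nw))
    (muw : 'cV[R]_nw) (Sw : 'M[R]_nw) (K : causal_law R n np)
    (w : int -> T -> 'cV[R]_nw) (x : int -> T -> 'cV[R]_n) : Prop :=
  StationaryLoop {
    loop_disturbance : iid_disturbance Pr w muw Sw;
    loop_dynamics : forall k t,
      let u := - (gain K x k t *m (Cv *m x k t + Dw *m w k t)) in
      x (k + 1) t = A *m x k t + Bu *m u + Bw *m w k t;
    loop_causal : forall k,
      indep_classes Pr (sigma_mx (w k))
        <<s sigma_mx (x k) `|` sigma_mx (gain K x k) >>;
    loop_stationary : strictly_stationary Pr x;
    loop_square_integrable : forall k, square_integrable Pr (x k)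
  }.

(* Main.v *)
(* With Acl = A - Bu Zbar Cv and M = Bw - Bu Zbar Dw, consider the storage
   function V(x) = (x - mux)^T P (x - mux) + 2 L^T (x - mux).  The Lyapunov
   equation for P and the choice of L give, along the closed loop,
     |y_k - ystar|^2
       = Jbar + phi(x_k, Z_k) + V(x_k) - V(x_{k+1}) + (noise terms),
   where the noise terms are linear or quadratic in w_k - muw, with
   coefficients that depend on (x_k, Z_k) only and are integrable because
   passivity and feasibility bound the entries of Z_k by 1.  Stationarity kills
   the mean of V(x_k) - V(x_{k+1}) and independence that of the noise terms.
   The formula for Jbar is the instance Z_k = Zbar, for which phi vanishes. *)
Require Import Defs.
From HB Require Import structures.
From mathcomp Require Import all_boot all_order all_algebra.
From mathcomp Require Import all_classical all_reals all_analysis.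
From mathcomp Require Import measurable_realfun.
From mathcomp Require Import ring lra.
Import Order.TTheory GRing.Theory Num.Theory numFieldNormedType.Exports.
Local Open Scope classical_set_scope.
Local Open Scope ring_scope.

Set Implicit Arguments.
Unset Strict Implicit.
Unset Printing Implicit Defensive.

(** * The storage function and its increments *)

Definition cvdot (R : comNzRingType) (m : nat) (u v : 'cV[R]_m) : R :=
  (u^T *m v) 0 0.

Lemma cvdotE (R : comNzRingType) (m : nat) (u v : 'cV[R]_m) :
  cvdot u v = \sum_i u i 0 * v i 0.
Proof. by rewrite /cvdot mxE; apply: eq_bigr => i _; rewrite mxE. Qed.

Lemma cvdotC (R : comNzRingType) (m : nat) (u v : 'cV[R]_m) :
  cvdot u v = cvdot v u.
Proof. by rewrite !cvdotE; apply: eq_bigr => i _; rewrite mulrC. Qed.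

Lemma cvdotDr (R : comNzRingType) (m : nat) (u v w : 'cV[R]_m) :
  cvdot u (v + w) = cvdot u v + cvdot u w.
Proof. by rewrite /cvdot mulmxDr mxE. Qed.

Lemma cvdotNr (R : comNzRingType) (m : nat) (u v : 'cV[R]_m) :
  cvdot u (- v) = - cvdot u v.
Proof. by rewrite /cvdot mulmxN mxE. Qed.

Lemma cvdotDl (R : comNzRingType) (m : nat) (u v w : 'cV[R]_m) :
  cvdot (v + w) u = cvdot v u + cvdot w u.
Proof. by rewrite cvdotC cvdotDr !(cvdotC u). Qed.

Lemma cvdotNl (R : comNzRingType) (m : nat) (u v : 'cV[R]_m) :
  cvdot (- v) u = - cvdot v u.
Proof. by rewrite cvdotC cvdotNr cvdotC. Qed.

Lemma cvdot_mull (R : comNzRingType) (m p : nat) (A : 'M[R]_(m, p)) u v :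
  cvdot (A *m u) v = cvdot u (A^T *m v).
Proof. by rewrite /cvdot trmx_mul mulmxA. Qed.

Lemma sqnorm2_cvdot (R : realType) (m : nat) (v : 'cV[R]_m) :
  sqnorm2 v = cvdot v v.
Proof. by rewrite cvdotE; apply: eq_bigr => i _; rewrite expr2. Qed.

Lemma cvdot_mxtrace (R : comNzRingType) (m : nat) (S : 'M[R]_m) v :
  cvdot v (S *m v) = \tr (S *m (v *m v^T)).
Proof.
by rewrite mulmxA mxtrace_mulC mulmxA /cvdot mulmxA /mxtrace big_ord1.
Qed.

Section StorageFunction.
Variables (R : realType) (n np ny nw : nat).
Variables (Acl P Sx : 'M[R]_n) (Bu : 'M[R]_(n, np)) (M : 'M[R]_(n, nw)).
Variables (Cv : 'M[R]_(np, n)) (Dw : 'M[R]_(np, nw)) (Cy : 'M[R]_(ny, n)).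
Variables (Sw : 'M[R]_nw) (muw : 'cV[R]_nw) (ystar : 'cV[R]_ny).
Variables (mux L : 'cV[R]_n).

Hypothesis Psym : P^T = P.
Hypothesis P_lyapunov : Acl^T *m P *m Acl = P - Cy^T *m Cy.
Hypothesis Sx_lyapunov : Sx = Acl *m Sx *m Acl^T + M *m Sw *m M^T.
Hypothesis mux_fixed : mux = Acl *m mux + M *m muw.
Hypothesis L_fixed : (Acl - 1%:M)^T *m L = Cy^T *m (ystar - Cy *m mux).

(** The linear term is there to absorb the cross term between the mean tracking error
    [Cy *m mux - ystar] and the deviation of the state; [L_fixed] tunes it for that. *)
Definition storage (x : 'cV[R]_n) : R :=
  cvdot (x - mux) (P *m (x - mux)) + 2 * cvdot L (x - mux).

(** With [M = Bw - Bu Zbar Dw] and [Z = Zbar + dZ] this is [Bw - Bu Z Dw], the coefficient of the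
    disturbance in the closed loop. *)
Definition noise_gain (dZ : 'M[R]_np) : 'M[R]_(n, nw) := M - Bu *m dZ *m Dw.

(** The predicted deviation of the next state from [mux], obtained by replacing the disturbance by
    its mean. *)
Definition drift (x : 'cV[R]_n) (dZ : 'M[R]_np) : 'cV[R]_n :=
  Acl *m (x - mux) - Bu *m dZ *m (Cv *m x + Dw *m muw).

(** The function $\phi$ of the theorem, with the increment [dZ] as argument in place of the gain. *)
Definition excess_cost (x : 'cV[R]_n) (dZ : 'M[R]_np) : R :=
  let r := Bu^T *m P *m Acl *m (x - mux) + Bu^T *m L in
  let q := Cv *m x + Dw *m muw in
  (q^T *m dZ^T *m (Bu^T *m P *m Bu) *m dZ *m q) 0 0 - 2 * (r^T *m dZ *m q) 0 0
  + \tr (Dw *m Sw *m Dw^T *m dZ^T *m (Bu^T *m P *m Bu) *m dZ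
         - 2 *: ((Bu^T *m P *m M *m Sw *m Dw^T)^T *m dZ)).

Definition static_cost : R :=
  \tr (Cy *m Sx *m Cy^T) + sqnorm2 (Cy *m mux - ystar).

Hypothesis Swsym : Sw^T = Sw.

(** Duality of the two Lyapunov equations: under the trace, the operator [X - Acl^T X Acl] applied
    to [P] moves onto [Sx] as its adjoint [Y - Acl Y Acl^T]. *)
Lemma static_trace : \tr (Cy *m Sx *m Cy^T) = \tr (M^T *m P *m M *m Sw).
Proof.
have -> : \tr (Cy *m Sx *m Cy^T) = \tr ((P - Acl^T *m P *m Acl) *m Sx).
  by rewrite P_lyapunov opprB addrC subrK mxtrace_mulC mulmxA.
rewrite mulmxBl raddfB /=.
have -> : \tr (Acl^T *m P *m Acl *m Sx) = \tr (P *m (Acl *m Sx *m Acl^T)).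
  by rewrite -!mulmxA mxtrace_mulC !mulmxA.
rewrite -raddfB -mulmxBr /=.
have -> : Sx - Acl *m Sx *m Acl^T = M *m Sw *m M^T.
  by rewrite {1}Sx_lyapunov addrC addrA addNr add0r.
by rewrite !mulmxA mxtrace_mulC !mulmxA.
Qed.

(** Expanding the quadratic form in [M - Bu dZ Dw] produces the trace part of $\phi$. The two cross
    terms agree because transposition preserves the trace and [P], [Sw] are symmetric. *)
Lemma noise_gain_trace (dZ : 'M[R]_np) :
  \tr ((noise_gain dZ)^T *m P *m noise_gain dZ *m Sw)
  = \tr (M^T *m P *m M *m Sw)
  + \tr (Dw *m Sw *m Dw^T *m dZ^T *m (Bu^T *m P *m Bu) *m dZ
         - 2 *: ((Bu^T *m P *m M *m Sw *m Dw^T)^T *m dZ)).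
Proof.
rewrite /noise_gain; set E := Bu *m dZ *m Dw.
rewrite [\tr (_ - 2 *: _)]raddfB /= linearZ /=.
have -> : \tr (Dw *m Sw *m Dw^T *m dZ^T *m (Bu^T *m P *m Bu) *m dZ)
  = \tr (E^T *m P *m E *m Sw).
  rewrite /E !trmx_mul -!mulmxA mxtrace_mulC -!mulmxA mxtrace_mulC.
  by rewrite -!mulmxA.
have trG : \tr ((Bu^T *m P *m M *m Sw *m Dw^T)^T *m dZ)
  = \tr (M^T *m P *m E *m Sw).
  rewrite !trmx_mul !trmxK Psym Swsym /E -!mulmxA mxtrace_mulC -!mulmxA.
  by rewrite mxtrace_mulC -!mulmxA.
have trE : \tr (E^T *m P *m M *m Sw) = \tr (M^T *m P *m E *m Sw).
  by rewrite -mxtrace_tr !trmx_mul Psym Swsym mxtrace_mulC /E !mulmxA !trmxK.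
rewrite trG [(M - E)^T]linearB /= !(mulmxBl, mulmxBr) !raddfB /= trE.
by ring.
Qed.

(* The Bellman-type identity behind the theorem: the right-hand side has zero
   mean, because x and dZ are independent of the disturbance w. *)
Lemma storage_increment (x : 'cV[R]_n) (w : 'cV[R]_nw) (dZ : 'M[R]_np) x' :
  x' = Acl *m x + M *m w - Bu *m dZ *m (Cv *m x + Dw *m w) ->
  sqnorm2 (Cy *m x - ystar) = static_cost + excess_cost x dZ
    + (storage x - storage x')
    + 2 * cvdot ((noise_gain dZ)^T *m (P *m drift x dZ + L)) (w - muw)
    + \tr ((noise_gain dZ)^T *m P *m noise_gain dZ
           *m ((w - muw) *m (w - muw)^T - Sw)).
Proof.
move=> x'E.
(* Subtracting the fixed-point equation of [mux] leaves the prediction plus a term linear in the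
   centred disturbance. *)
have dx' : x' - mux = drift x dZ + noise_gain dZ *m (w - muw).
  rewrite x'E {1}mux_fixed /drift /noise_gain !mulmxBr !mulmxBl !mulmxDr.
  rewrite !mulmxA; set a := Acl *m x; set b := M *m w; set c := M *m muw.
  set e := Acl *m mux; set f := _ *m _ *m x; set g := _ *m _ *m muw.
  set h := _ *m _ *m w.
  by apply/matrixP => i j; rewrite !mxE; ring.
rewrite [_ *m (_ - Sw)]mulmxBr [\tr (_ - _ *m Sw)]raddfB /= -cvdot_mxtrace.
rewrite /static_cost /storage dx'.
rewrite noise_gain_trace static_trace /excess_cost.
set N := noise_gain dZ; set om := w - muw; set m := x - mux.
set q := Cv *m x + Dw *m muw; set T1 := \tr (_ *m P *m M *m Sw).
set T2 := \tr (_ - _).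
pose b := Bu *m dZ *m q.
have driftE : drift x dZ = Acl *m m - b by [].
rewrite driftE.
have -> : (q^T *m dZ^T *m (Bu^T *m P *m Bu) *m dZ *m q) 0 0 = cvdot b (P *m b).
  by rewrite /cvdot /b !trmx_mul !mulmxA.
have -> : ((Bu^T *m P *m Acl *m m + Bu^T *m L)^T *m dZ *m q) 0 0
    = cvdot (P *m (Acl *m m)) b + cvdot L b.
  rewrite -cvdotDl /cvdot /b !mulmxA; congr ((_ *m _) _ _).
  by rewrite -!mulmxA -mulmxDr trmx_mul trmxK !mulmxA.
(* By the Lyapunov equation, the quadratic part of the storage drops along [Acl] by exactly the
   squared norm of [Cy *m m]. *)
have quadA : cvdot (Acl *m m) (P *m (Acl *m m))
    = cvdot m (P *m m) - cvdot (Cy *m m) (Cy *m m).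
  rewrite cvdot_mull !mulmxA P_lyapunov mulmxBl cvdotDr cvdotNr cvdot_mull.
  by rewrite !mulmxA.
have PC u v : cvdot u (P *m v) = cvdot v (P *m u).
  by rewrite cvdotC cvdot_mull Psym.
have crossN u : cvdot (N^T *m u) om = cvdot u (N *m om).
  by rewrite cvdot_mull trmxK.
have quadN : cvdot om (N^T *m P *m N *m om) = cvdot (N *m om) (P *m (N *m om)).
  by rewrite cvdot_mull !mulmxA.
(* Twice this is, up to sign, the cross term in the squared norm of
   [Cy *m m + (Cy *m mux - ystar)]. *)
have LA : cvdot L (Acl *m m) - cvdot L m = cvdot (ystar - Cy *m mux) (Cy *m m).
  rewrite -cvdotNr -cvdotDr.
  have -> : Acl *m m - m = (Acl - 1%:M) *m m by rewrite mulmxBl mul1mx.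
  by rewrite cvdotC cvdot_mull L_fixed -[in RHS]cvdotC cvdot_mull.
have -> : Cy *m x - ystar = Cy *m m + (Cy *m mux - ystar).
  by rewrite /m mulmxBr addrA subrK.
rewrite !sqnorm2_cvdot crossN quadN.
move: LA; rewrite -[ystar - _]opprB cvdotNl; set d := Cy *m mux - ystar => LA.
set e := N *m om.
clearbody m d e b.
rewrite !(mulmxDr, mulmxN) !(cvdotDl, cvdotDr, cvdotNl, cvdotNr).
rewrite quadA -!(cvdotC d).
rewrite [cvdot (P *m (Acl *m m)) b]cvdotC [cvdot (P *m _) e]cvdotC.
rewrite [cvdot (P *m b) e]cvdotC.
rewrite !(PC b) !(PC e) -/b.
have {LA} -> : cvdot L (Acl *m m) = cvdot L m - cvdot d (Cy *m m) by lra.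
rewrite (PC (Acl *m m) b) (PC (Acl *m m) e); ring.
Qed.

End StorageFunction.

(** * Invertibility from uniqueness, and gain bounds from passivity and feasibility *)

Lemma trmx_mul_eq0 (R : realType) (n : nat) (v : 'rV[R]_n) :
  v^T *m v = 0 -> v = 0.
Proof.
move=> v0; apply/rowP => i; rewrite mxE; apply/eqP.
have := congr1 (fun X : 'M[R]_n => X i i) v0.
by rewrite !mxE big_ord1 !mxE => /eqP; rewrite mulf_eq0 orbb.
Qed.

(* If v Acl = v, then P + v^T v solves the equation as well. *)
Lemma lyapunov_unique_unitmx (R : realType) (n : nat) (Acl P Q : 'M[R]_n) :
  unique (fun X : 'M[R]_n => 0 = Acl^T *m X *m Acl - X + Q) P ->
  (1%:M - Acl) \in unitmx.
Proof.
move=> [hP Puniq].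
rewrite -row_free_unit -kermx_eq0; apply/eqP/row_matrixP => i.
rewrite row0; set v := row i _.
have vA : v *m Acl = v.
  have : v *m (1%:M - Acl) = 0 by rewrite /v -row_mul mulmx_ker row0.
  by rewrite mulmxBr mulmx1 => /eqP; rewrite subr_eq0 => /eqP.
apply: trmx_mul_eq0.
suff : P = P + v^T *m v.
  by move/eqP; rewrite -subr_eq0 opprD addNKr oppr_eq0 => /eqP.
apply: Puniq; rewrite mulmxDr mulmxDl.
have -> : Acl^T *m (v^T *m v) *m Acl = v^T *m v.
  by rewrite mulmxA -trmx_mul vA -mulmxA vA.
by rewrite opprD addrACA subrr addr0.
Qed.

(** Over a horizon of one step from rest the state is still zero, so the supplied energy reduces to
    the direct feedthrough term. *)
Lemma passive_Du (R : realType) (n np : nat) (A : 'M[R]_n)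
    (Bu : 'M[R]_(n, np)) (Cv : 'M[R]_(np, n)) (Du : 'M[R]_np) :
  passive A Bu Cv Du -> forall u : 'cV[R]_np, 0 <= cvdot u (Du *m u).
Proof.
move=> hpass u.
pose x := fix x k : 'cV[R]_n := if k is k'.+1 then A *m x k' + Bu *m u else 0.
have := hpass (fun=> u) x erefl (fun=> erefl) 1%N.
by rewrite big_ord1 /= mulmx0 add0r.
Qed.

(* Apply both sides of the feasibility inequality to the j-th basis vector:
   as Du is positive semidefinite, the j-th column z of Z satisfies
   |z|^2 <= z_j. *)
Lemma feasible_bounded (R : realType) (np : nat) (Du Z : 'M[R]_np) :
  (forall u : 'cV[R]_np, 0 <= cvdot u (Du *m u)) -> feasible Du Z ->
  forall i j, `|Z i j| <= 1.
Proof.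
move=> Du0 [_ Zfeas] i j.
pose e : 'cV[R]_np := delta_mx j 0; pose z := Z *m e.
have ze k : z k 0 = Z k j by rewrite /z -colE mxE.
have ez : cvdot e z = Z j j.
  rewrite cvdotE (bigD1 j) //= mxE !eqxx mul1r big1 ?addr0 ?ze// => k kj.
  by rewrite mxE (negbTE kj) mul0r.
have := Zfeas e; rewrite sub0r !opprB -mulmxA.
rewrite -[X in 0 <= X]/(cvdot e _).
have -> : (2^-1 *: Z
    + (2^-1 *: Z^T - Z^T *m (1%:M + 2^-1 *: (Du + Du^T)) *m Z)) *m e
  = 2^-1 *: z
    + (2^-1 *: (Z^T *m e) - Z^T *m (z + 2^-1 *: (Du *m z + Du^T *m z))).
  rewrite mulmxDl mulmxBl -!scalemxAl -!mulmxA -/z mulmxDl mul1mx -scalemxAl.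
  by rewrite mulmxDl.
have dotZ a (u v : 'cV[R]_np) : cvdot u (a *: v) = a * cvdot u v.
  by rewrite /cvdot -scalemxAr mxE.
rewrite !(cvdotDr, cvdotNr, dotZ) -!cvdot_mull -/z !(cvdotDr, dotZ).
rewrite -(cvdot_mull Du) (cvdotC z e) ez [cvdot (Du *m z) z]cvdotC => h.
have zz : cvdot z z <= Z j j by have := Du0 z; lra.
have sq k : Z k j ^+ 2 <= Z j j.
  apply: le_trans zz; rewrite cvdotE (bigD1 k)//= !ze expr2 lerDl.
  by apply: sumr_ge0 => l _; rewrite -expr2 sqr_ge0.
(* The square of [Z j j] is at most [Z j j], which excludes values above 1; the rest of the column
   then follows from [sq]. *)
have Zjj : Z j j <= 1.
  have := sq j; rewrite leNgt => h1; apply/negP => h2; nra.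
rewrite -(@ler_pXn2r _ 2)// ?nnegrE// expr1n -normrX ger0_norm ?sqr_ge0//.
exact: le_trans (sq i) Zjj.
Qed.

(** * Products of independent random variables *)

Lemma expectation_law d (T : measurableType d) (R : realType)
    (Pr : probability T R) (Z : T -> R) (mZ : measurable_fun setT Z) :
  Z \in Lfun Pr 1 ->
  ('E_Pr[Z] = \int[distribution Pr (mfun_Sub (mem_set mZ))]_z z%:E)%E.
Proof.
move=> Z1.
rewrite (@integral_distribution _ _ _ _ _ Pr (mfun_Sub (mem_set mZ)))//.
  by rewrite unlock.
exact/Lfun1_integrable.
Qed.

Section IndependentProduct.
Context d (T : measurableType d) (R : realType) (Pr : probability T R).
Variables X Y : T -> R.
Hypothesis X1 : X \in Lfun Pr 1.
Hypothesis Y1 : Y \in Lfun Pr 1.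
Hypothesis XY_indep : forall B C : set R, measurable B -> measurable C ->
  Pr (X @^-1` B `&` Y @^-1` C) = (Pr (X @^-1` B) * Pr (Y @^-1` C))%E.

Let mX : measurable_fun setT X.
Proof. by move: X1; rewrite inE => /andP[/[!inE]]. Qed.

Let mY : measurable_fun setT Y.
Proof. by move: Y1; rewrite inE => /andP[/[!inE]]. Qed.

Let Xm : {mfun T >-> R} := mfun_Sub (mem_set mX).
Let Ym : {mfun T >-> R} := mfun_Sub (mem_set mY).

Let mXY : measurable_fun setT (fun t => (X t, Y t)).
Proof. exact: measurable_fun_pair. Qed.

Let XYm : {mfun T >-> (R * R)%type} := mfun_Sub (mem_set mXY).

Let lawX : probability _ R := distribution Pr Xm.
Let lawY : probability _ R := distribution Pr Ym.

Let mul2 (z : R * R) : \bar R := (z.1 * z.2)%:E.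

Let mmul : measurable_fun setT mul2.
Proof. by apply/measurable_EFinP; apply: measurable_funM. Qed.

Let mabs : measurable_fun setT (fun y : R => `|y%:E|%E).
Proof. by apply: measurableT_comp. Qed.

Let mul2E x y : mul2 (x, y) = (x%:E * y%:E)%E.
Proof. exact: EFinM. Qed.

(** Independence gives agreement on measurable rectangles, and uniqueness of the product measure
    extends it to all measurable sets. *)
Let joint_law A : measurable A -> (lawX \x lawY)%E A = distribution Pr XYm A.
Proof. by move=> mA; exact: product_measure_unique. Qed.

Let ge0_integral_joint (f : R * R -> \bar R) : measurable_fun setT f ->
  (forall z, 0 <= f z)%E ->
  (\int[lawX \x lawY]_z f z = \int[Pr]_t f (X t, Y t))%E.
Proof.
move=> mf f0; rewrite -[RHS](ge0_integral_distribution XYm)//.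
by apply: eq_measure_integral => // A mA _; exact: joint_law.
Qed.

Let int_id (Z : T -> R) (mZ : measurable_fun setT Z) : Z \in Lfun Pr 1 ->
  (distribution Pr (mfun_Sub (mem_set mZ))).-integrable setT (EFin \o id).
Proof.
move=> /Lfun1_integrable /integrableP[_ Zfin]; apply/integrableP; split.
  exact/measurable_EFinP.
by rewrite ge0_integral_distribution.
Qed.

(** By Tonelli the absolute integral factors into the two first absolute moments, so integrability
    of each factor suffices. *)
Let mulXY : (lawX \x lawY)%E.-integrable setT mul2.
Proof.
apply/integrable12ltyP => //.
under eq_integral => x _.
  under eq_integral => y _ do rewrite mul2E abseM.
  rewrite ge0_integralZl//.
  over.
have /integrableP[_ Yfin] := int_id mY Y1.
have /integrableP[_ Xfin] := int_id mX X1.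
have fY : (\int[lawY]_y `|y%:E|)%E \is a fin_num.
  by rewrite ge0_fin_numE// integral_ge0.
rewrite -(fineK fY) ge0_integralZr//.
- by rewrite lte_mul_pinfty ?integral_ge0 ?ge0_fin_numE ?integral_ge0 ?fineK.
- by rewrite lee_fin fine_ge0 ?integral_ge0.
Qed.

Lemma indep_mul_Lfun1 : X \* Y \in Lfun Pr 1.
Proof.
apply/Lfun1_integrable/integrableP; split.
  exact/measurable_EFinP/measurable_funM.
have /integrableP[_] := mulXY.
by rewrite ge0_integral_joint//; exact: measurableT_comp.
Qed.

Lemma indep_expectation_mul : ('E_Pr[X \* Y] = 'E_Pr[X] * 'E_Pr[Y])%E.
Proof.
have -> : ('E_Pr[X \* Y] = \int[lawX \x lawY]_z mul2 z)%E.
  transitivity (\int[distribution Pr XYm]_z mul2 z)%E.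
    rewrite integral_distribution//; first by rewrite unlock.
    exact/Lfun1_integrable/indep_mul_Lfun1.
  by apply: eq_measure_integral => // A mA _; exact/esym/joint_law.
rewrite -(integral12_prod_meas1 mulXY) /fubini_F /=.
rewrite (expectation_law mX X1) (expectation_law mY Y1).
have fY : (\int[lawY]_y y%:E)%E \is a fin_num.
  exact: integrable_fin_num (int_id mY Y1).
under eq_integral => x _.
  under eq_integral => y _ do rewrite mul2E.
  rewrite integralZl//; last exact: int_id.
  over.
rewrite -/lawX -/lawY -(fineK fY) integralZr//; exact: int_id.
Qed.

End IndependentProduct.

(** * Measurability, integrability and independence of random matrices *)

(** Good-sets argument: the sets with measurable preimage form a sigma-algebra, so it is enough to
    test generators. *)
Lemma measurable_preimage_sigma d (T : measurableType d) (U : Type)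
    (f : T -> U) (G : set (set U)) :
  (forall A, G A -> measurable (f @^-1` A)) ->
  forall A, <<s G >> A -> measurable (f @^-1` A).
Proof.
move=> fG A GA; apply: (GA [set A | measurable (f @^-1` A)]); split => //.
split => /=.
- by rewrite preimage_set0.
- by move=> B mB; rewrite setTD preimage_setC; exact: measurableC.
- by move=> F mF; rewrite preimage_bigcup; exact: bigcupT_measurable.
Qed.

Lemma fun_sum_closed (T : Type) (R : nmodType) (I : Type)
    (Q : (T -> R) -> Prop) (s : seq I) (f : I -> T -> R) :
  Q (fun=> 0) -> (forall g h, Q g -> Q h -> Q (fun t => g t + h t)) ->
  (forall i, Q (f i)) -> Q (fun t => \sum_(i <- s) f i t).
Proof.
move=> Q0 QD Qf; elim: s => [|i s IHs].
  by under eq_fun do rewrite big_nil.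
by under eq_fun do rewrite big_cons; exact: QD.
Qed.

(** A common frame for measurable, bounded, integrable and centred random matrices, so that closure
    under matrix operations can be shared. *)
Definition entrywise (R T : Type) (Q : (T -> R) -> Prop) (m n : nat)
  (X : T -> 'M[R]_(m, n)) : Prop := forall i j, Q (fun t => X t i j).

Section Entrywise.
Variables (T : Type) (R : nzRingType) (Q1 Q2 Q3 : (T -> R) -> Prop).
Hypothesis Q0 : Q3 (fun=> 0).
Hypothesis QD : forall g h, Q3 g -> Q3 h -> Q3 (fun t => g t + h t).
Hypothesis QM : forall g h, Q1 g -> Q2 h -> Q3 (fun t => g t * h t).

Lemma entrywiseD (m n : nat) (X Y : T -> 'M[R]_(m, n)) :
  entrywise Q3 X -> entrywise Q3 Y -> entrywise Q3 (fun t => X t + Y t).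
Proof.
by move=> QX QY i j; under eq_fun do rewrite mxE; apply: QD.
Qed.

(** The factors and the product may lie in different classes: a bounded measurable matrix times an
    integrable one is integrable. *)
Lemma entrywise_mulmx (m n p : nat) (X : T -> 'M[R]_(m, n))
    (Y : T -> 'M[R]_(n, p)) :
  entrywise Q1 X -> entrywise Q2 Y -> entrywise Q3 (fun t => X t *m Y t).
Proof.
move=> QX QY i j; under eq_fun do rewrite mxE.
by apply: fun_sum_closed => // l; apply: QM.
Qed.

End Entrywise.

Lemma entrywise_tr (T R : Type) (Q : (T -> R) -> Prop) (m n : nat)
    (X : T -> 'M[R]_(m, n)) :
  entrywise Q X -> entrywise Q (fun t => (X t)^T).
Proof. by move=> QX i j; under eq_fun do rewrite mxE. Qed.

Lemma entrywise_cst (T R : Type) (Q : (T -> R) -> Prop) (m n : nat)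
    (A : 'M[R]_(m, n)) :
  (forall c, Q (fun=> c)) -> entrywise Q (fun=> A).
Proof. by move=> Qc i j. Qed.

Section Measurable.
Context d (T : measurableType d) (R : realType).

Definition measurable_mx (m n : nat) : (T -> 'M[R]_(m, n)) -> Prop :=
  entrywise (fun f : T -> R => measurable_fun setT f) (n := n).

Lemma measurable_mx_cst (m n : nat) (A : 'M[R]_(m, n)) :
  measurable_mx (fun=> A).
Proof. by apply: entrywise_cst => c. Qed.

Lemma measurable_mxD (m n : nat) (X Y : T -> 'M[R]_(m, n)) :
  measurable_mx X -> measurable_mx Y -> measurable_mx (fun t => X t + Y t).
Proof. by apply: entrywiseD => g h; exact: measurable_funD. Qed.

Lemma measurable_mulmx (m n p : nat) (X : T -> 'M[R]_(m, n))
    (Y : T -> 'M[R]_(n, p)) :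
  measurable_mx X -> measurable_mx Y -> measurable_mx (fun t => X t *m Y t).
Proof.
by apply: entrywise_mulmx => // g h; [exact: measurable_funD|
  exact: measurable_funM].
Qed.

Lemma measurable_mxN (m n : nat) (X : T -> 'M[R]_(m, n)) :
  measurable_mx X -> measurable_mx (fun t => - X t).
Proof.
move=> mX i j; under eq_fun do rewrite mxE.
exact: measurableT_comp (mX i j).
Qed.

Lemma measurable_cvdot (m : nat) (X Y : T -> 'cV[R]_m) :
  measurable_mx X -> measurable_mx Y ->
  measurable_fun setT (fun t => cvdot (X t) (Y t)).
Proof.
move=> mX mY.
have mXt : measurable_mx (fun t => (X t)^T) by exact: entrywise_tr.
exact: measurable_mulmx mXt mY 0 0.
Qed.

End Measurable.

Section Bounded.
Context (T : Type) (R : realType).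

Definition bounded_mx (m n : nat) : (T -> 'M[R]_(m, n)) -> Prop :=
  entrywise (fun f : T -> R => exists c, forall t, `|f t| <= c) (n := n).

Lemma bounded_mx_cst (m n : nat) (A : 'M[R]_(m, n)) : bounded_mx (fun=> A).
Proof. by apply: entrywise_cst => c; exists `|c|. Qed.

Let bndD (g h : T -> R) : (exists c, forall t, `|g t| <= c) ->
  (exists c, forall t, `|h t| <= c) ->
  exists c, forall t, `|g t + h t| <= c.
Proof.
move=> [a ga] [b hb]; exists (a + b) => t.
exact: le_trans (ler_normD _ _) (lerD _ _).
Qed.

Lemma bounded_mxD (m n : nat) (X Y : T -> 'M[R]_(m, n)) :
  bounded_mx X -> bounded_mx Y -> bounded_mx (fun t => X t + Y t).
Proof. exact: entrywiseD. Qed.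

Lemma bounded_mulmx (m n p : nat) (X : T -> 'M[R]_(m, n))
    (Y : T -> 'M[R]_(n, p)) :
  bounded_mx X -> bounded_mx Y -> bounded_mx (fun t => X t *m Y t).
Proof.
apply: entrywise_mulmx => //; first by exists 0 => t; rewrite normr0.
by move=> g h [a ga] [b hb]; exists (a * b) => t; rewrite normrM ler_pM.
Qed.

Lemma bounded_mxN (m n : nat) (X : T -> 'M[R]_(m, n)) :
  bounded_mx X -> bounded_mx (fun t => - X t).
Proof.
move=> bX i j; have [c cX] := bX i j; exists c => t.
by rewrite mxE normrN.
Qed.

End Bounded.

Section Integrable.
Context d (T : measurableType d) (R : realType) (Pr : probability T R).

Definition integrable_mx (m n : nat) : (T -> 'M[R]_(m, n)) -> Prop :=
  entrywise (fun f : T -> R => f \in Lfun Pr 1) (n := n).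

Let LfunD r (g h : T -> R) : 1 <= r -> g \in Lfun Pr r%:E ->
  h \in Lfun Pr r%:E -> (fun t => g t + h t) \in Lfun Pr r%:E.
Proof. by move=> r1 ? ?; apply: rpredD. Qed.

Lemma integrable_mxD (m n : nat) (X Y : T -> 'M[R]_(m, n)) :
  integrable_mx X -> integrable_mx Y -> integrable_mx (fun t => X t + Y t).
Proof. by apply: entrywiseD => g h; exact: LfunD. Qed.

Lemma integrable_mxN (m n : nat) (X : T -> 'M[R]_(m, n)) :
  integrable_mx X -> integrable_mx (fun t => - X t).
Proof.
by move=> iX i j; under eq_fun do rewrite mxE; have := iX i j; rewrite -rpredN.
Qed.

Lemma integrable_mulmx (m n p : nat) (X : T -> 'M[R]_(m, n))
    (Y : T -> 'M[R]_(n, p)) :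
  measurable_mx X -> bounded_mx X -> integrable_mx Y ->
  integrable_mx (fun t => X t *m Y t).
Proof.
move=> mX bX; pose Q (f : T -> R) :=
  measurable_fun setT f /\ exists c, forall t, `|f t| <= c.
have : entrywise Q X by move=> i j; split; [exact: mX|exact: bX].
apply: entrywise_mulmx => [|g h|g h [mg [c gc]] /Lfun1_integrable ih].
- exact: Lfun_cst.
- exact: LfunD.
- apply/Lfun1_integrable.
  apply: (integrableMr measurableT mg _ ih).
  exists c; split; first by rewrite num_real.
  by move=> M cM t _; exact: le_trans (gc t) (ltW cM).
Qed.

Lemma integrable_mx_cst (m n : nat) (A : 'M[R]_(m, n)) :
  integrable_mx (fun=> A).
Proof. by apply: entrywise_cst => c; exact: Lfun_cst. Qed.

Lemma bounded_integrable_mx (m n : nat) (X : T -> 'M[R]_(m, n)) :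
  measurable_mx X -> bounded_mx X -> integrable_mx X.
Proof.
move=> mX bX; have := integrable_mulmx mX bX (integrable_mx_cst 1%:M).
by under eq_fun do rewrite mulmx1.
Qed.

Lemma square_integrable_cst (m : nat) (v : 'cV[R]_m) :
  square_integrable Pr (fun=> v).
Proof. by move=> i; exact: Lfun_cst. Qed.

Lemma square_integrableD (m : nat) (X Y : T -> 'cV[R]_m) :
  square_integrable Pr X -> square_integrable Pr Y ->
  square_integrable Pr (fun t => X t + Y t).
Proof.
move=> sX sY i; under eq_fun do rewrite mxE.
by apply: LfunD => //; rewrite ler1n.
Qed.

Lemma square_integrable_mulmx (m n : nat) (A : 'M[R]_(m, n)) X :
  square_integrable Pr X -> square_integrable Pr (fun t => A *m X t).
Proof.
move=> sX i; under eq_fun do rewrite mxE.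
have r1 : 1 <= 2 :> R by rewrite ler1n.
apply: (fun_sum_closed (Q := fun f => f \in Lfun Pr 2%:E)) => [|g h|l].
- exact: Lfun_cst.
- exact: LfunD.
- under eq_fun do rewrite mulrC.
  exact: Lfun_scale.
Qed.

Lemma Lfun1_cvdot (m : nat) (X Y : T -> 'cV[R]_m) :
  square_integrable Pr X -> square_integrable Pr Y ->
  (fun t => cvdot (X t) (Y t)) \in Lfun Pr 1.
Proof.
move=> sX sY; under eq_fun do rewrite cvdotE.
apply: (fun_sum_closed (Q := fun f => f \in Lfun Pr 1)) => [|g h|l].
- exact: Lfun_cst.
- exact: LfunD.
- exact: Lfun2_mul_Lfun1.
Qed.

Lemma square_integrable_mx (m : nat) (X : T -> 'cV[R]_m) :
  square_integrable Pr X -> integrable_mx X.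
Proof.
move=> sX i j; rewrite ord1; apply: Lfun_subset12; last exact: sX.
by rewrite fin_num_measure.
Qed.

Lemma square_integrable_measurable (m : nat) (X : T -> 'cV[R]_m) :
  square_integrable Pr X -> measurable_mx X.
Proof.
by move=> sX i j; rewrite ord1; move: (sX i); rewrite inE => /andP[/[!inE]].
Qed.

(** Integrability is included because the expectation is a total function whose additivity needs
    it. *)
Definition zero_mean (f : T -> R) : Prop :=
  f \in Lfun Pr 1 /\ ('E_Pr[f] = 0)%E.

Lemma zero_meanD (f g : T -> R) : zero_mean f -> zero_mean g ->
  zero_mean (fun t => f t + g t).
Proof.
move=> [f1 f0] [g1 g0]; split; first exact: LfunD.
by rewrite (expectationD f1 g1) f0 g0 adde0.
Qed.

Lemma zero_meanZ (c : R) (f : T -> R) : zero_mean f ->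
  zero_mean (fun t => c * f t).
Proof.
move=> [f1 f0]; under eq_fun do rewrite mulrC.
by split; [exact: Lfun_scale|rewrite (expectationZl c f1) f0 mule0].
Qed.

Lemma zero_mean0 : zero_mean (fun=> 0).
Proof. by split; [exact: Lfun_cst|rewrite (expectation_cst _ 0)]. Qed.

End Integrable.

Section IndependentNoise.
Context d (T : measurableType d) (R : realType) (Pr : probability T R).
Variables F G : set (set T).
Hypothesis FG_indep : indep_classes Pr F <<s G >>.

(* Typing H on [g_sigma_algebraType G] makes [measurable_mx H] mean
   measurability with respect to the sub-sigma-algebra <<s G>>. *)
Lemma zero_mean_indep_mulmx (m n : nat)
    (H : g_sigma_algebraType G -> 'M[R]_(m, n)) (V : T -> 'M[R]_(n, m)) :
  measurable_mx H -> integrable_mx Pr H ->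
  (forall i j, zero_mean Pr (fun t => V t i j)) ->
  (forall i j B, measurable B -> F ((fun t => V t i j) @^-1` B)) ->
  zero_mean Pr (fun t => \tr (H t *m V t)).
Proof.
move=> mH iH V0 FV.
have HV : entrywise (zero_mean Pr) (fun t => H t *m V t).
  move=> i j; under eq_fun do rewrite mxE.
  apply: fun_sum_closed => [||l]; [exact: zero_mean0|exact: zero_meanD|].
  have indep B C : measurable B -> measurable C ->
      (Pr ((fun t => H t i l) @^-1` B `&` (fun t => V t l j) @^-1` C)
       = Pr ((fun t => H t i l) @^-1` B) * Pr ((fun t => V t l j) @^-1` C))%E.
    move=> mB mC; rewrite setIC muleC; apply: FG_indep; first exact: FV.
    by have := mH i l measurableT B mB; rewrite setTI.
  have [V1 VE] := V0 l j.
  split; first exact: (indep_mul_Lfun1 (iH i l) V1 indep).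
  by rewrite (indep_expectation_mul (iH i l) V1 indep) VE mule0.
apply: (fun_sum_closed (Q := zero_mean Pr)) => //.
  exact: zero_mean0.
exact: zero_meanD.
Qed.

End IndependentNoise.

(** * Borel functions of random matrices, and stationarity of their means *)

Definition mx_entry_sets (R : realType) (m n : nat) : set (set 'M[R]_(m, n)) :=
  \bigcup_(ij in [set: 'I_m * 'I_n])
    preimage_set_system setT (fun X : 'M[R]_(m, n) => X ij.1 ij.2) measurable.

Lemma borel_mx_entry (R : realType) (m n : nat) i j (B : set R) :
  measurable B -> borel_mx ((fun X : 'M[R]_(m, n) => X i j) @^-1` B).
Proof.
move=> mB; apply: sub_sigma_algebra; exists (i, j) => //.
by exists B => //; rewrite setTI.
Qed.

(** The sigma-algebra on the source is [borel_mx]. This is the seed from which polynomial functions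
    of a matrix are shown to be Borel. *)
Lemma measurable_mx_id (R : realType) (m n : nat) :
  measurable_mx
    (id : g_sigma_algebraType (@mx_entry_sets R m n) -> 'M[R]_(m, n)).
Proof. by move=> i j _ B mB; rewrite setTI; exact: borel_mx_entry. Qed.

Lemma measurable_borel_preimage d (T : measurableType d) (R : realType)
    (m n : nat) (X : T -> 'M[R]_(m, n)) :
  measurable_mx X -> forall B, borel_mx B -> measurable (X @^-1` B).
Proof.
move=> mX; apply: measurable_preimage_sigma => _ [[i j] _] [B mB <-].
by rewrite setTI; have := mX i j measurableT B mB; rewrite setTI.
Qed.

Lemma sigma_mx_measurable (T : pointedType) (R : realType) (m n : nat)
    (X : T -> 'M[R]_(m, n)) (G : set (set T)) :
  sigma_mx X `<=` G ->
  measurable_mx (X : g_sigma_algebraType G -> 'M[R]_(m, n)).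
Proof.
move=> XG i j _ B mB; rewrite setTI; apply: sub_sigma_algebra; apply: XG.
by exists ((fun X => X i j) @^-1` B); [exact: borel_mx_entry|rewrite setTI].
Qed.

(** Stationarity for a single index and shift 1 says that [x k] and [x (k + 1)] have the same law,
    and an expectation depends on the law only. *)
Lemma stationary_zero_mean d (T : measurableType d) (R : realType)
    (Pr : probability T R) (n : nat) (x : int -> T -> 'cV[R]_n)
    (f : g_sigma_algebraType (@mx_entry_sets R n 1) -> R) (k : int) :
  strictly_stationary Pr x -> measurable_fun setT f ->
  (f \o x k) \in Lfun Pr 1 -> (f \o x (k + 1)) \in Lfun Pr 1 ->
  zero_mean Pr (fun t => f (x k t) - f (x (k + 1) t)).
Proof.
move=> xstat mf f1 f2; split; first by apply: rpredB.
have mL (g : T -> R) : g \in Lfun Pr 1 -> measurable_fun setT g.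
  by rewrite inE => /andP[/[!inE]].
rewrite (expectationB f1 f2).
suff -> : ('E_Pr[f \o x k] = 'E_Pr[f \o x (k + 1)%R])%E.
  by rewrite subee// expectation_fin_num.
rewrite (expectation_law (mL _ f1) f1) (expectation_law (mL _ f2) f2).
apply: eq_measure_integral => // B mB _; rewrite /distribution /pushforward /=.
have mfB : borel_mx (f @^-1` B).
  by have := mf measurableT B mB; rewrite setTI.
by have := xstat [:: k] 1 (fun=> f @^-1` B) (fun=> mfB); rewrite !big_seq1.
Qed.

Lemma sigma_mx_comp (T : Type) (R : realType) (m n : nat)
    (X : T -> 'M[R]_(m, n))
    (f : g_sigma_algebraType (@mx_entry_sets R m n) -> R) (B : set R) :
  measurable_fun setT f -> measurable B ->
  sigma_mx X ((fun t => f (X t)) @^-1` B).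
Proof.
move=> mf mB; exists (f @^-1` B); last by rewrite setTI.
by have := mf measurableT B mB; rewrite setTI.
Qed.

(** The gain is [K] composed with the map from outcomes to state histories, which is measurable
    coordinate by coordinate. *)
Lemma measurable_gain d (T : measurableType d) (R : realType) (n np : nat)
    (K : causal_law R n np) (x : int -> T -> 'cV[R]_n) (k : int) :
  measurable_law K -> (forall l, measurable_mx (x l)) ->
  forall B, borel_mx B -> measurable (gain K x k @^-1` B).
Proof.
move=> mK mx B mB.
pose hist (t : T) (j : nat) := x (k - j%:Z) t.
rewrite -[_ @^-1` _]/(hist @^-1` (K @^-1` B)).
apply: measurable_preimage_sigma (mK B mB) => _ [j _] [C mC <-].
by rewrite setTI; exact: (measurable_borel_preimage (mx (k - j%:Z)) mC).
Qed.

(** * First and second moments of the centred disturbance *)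

Section CentredNoise.
Context d (T : measurableType d) (R : realType) (Pr : probability T R).
Variables (nw : nat) (w : int -> T -> 'cV[R]_nw) (muw : 'cV[R]_nw).
Variable Sw : 'M[R]_nw.
Hypothesis w_iid : iid_disturbance Pr w muw Sw.

Lemma zero_mean_noise (k : int) i j :
  zero_mean Pr (fun t => (w k t - muw) i j).
Proof.
have w1 := square_integrable_mx (iid_square_integrable w_iid k) i 0.
rewrite ord1; under eq_fun do rewrite !mxE.
split; first by apply: rpredB => //; exact: Lfun_cst.
rewrite (expectationB w1 (Lfun_cst _ _ _)) (iid_mean w_iid) expectation_cst.
by rewrite subee.
Qed.

Lemma zero_mean_noise_sqr (k : int) i j :
  zero_mean Pr (fun t => ((w k t - muw) *m (w k t - muw)^T - Sw) i j).
Proof.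
have sw : square_integrable Pr (fun t => w k t - muw).
  apply: square_integrableD; first exact: (iid_square_integrable w_iid).
  exact: square_integrable_cst.
have ww1 : (fun t => (w k t - muw) i 0 * (w k t - muw) j 0) \in Lfun Pr 1.
  exact: Lfun2_mul_Lfun1 (sw i) (sw j).
have -> : (fun t => ((w k t - muw) *m (w k t - muw)^T - Sw) i j)
    = (fun t => (w k t - muw) i 0 * (w k t - muw) j 0 - Sw i j).
  by apply/funext => t; rewrite mxE mxE big_ord1 [_^T _ _]mxE [(- Sw) _ _]mxE.
split; first by apply: rpredB => //; exact: Lfun_cst.
rewrite (expectationB ww1 (Lfun_cst _ _ _)) expectation_cst.
set f := fun t => _; suff -> : ('E_Pr[f] = (Sw i j)%:E)%E by rewrite subee.
(* The covariance is by definition the mean of the product of the centred entries. *)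
rewrite -(iid_covariance w_iid k) covariance.unlock !(iid_mean w_iid) /=.
by congr expectation; apply/funext => t; rewrite /f !mxE.
Qed.

End CentredNoise.

(** * Cost of a stationary closed loop *)

Section ClosedLoopCost.
Variables (R : realType) (n np ny nw : nat).
Variables (A : 'M[R]_n) (Bu : 'M[R]_(n, np)) (Bw : 'M[R]_(n, nw)).
Variables (Cv : 'M[R]_(np, n)) (Dw : 'M[R]_(np, nw)) (Cy : 'M[R]_(ny, n)).
Variables (muw : 'cV[R]_nw) (Sw : 'M[R]_nw) (ystar : 'cV[R]_ny).
Variables (Zbar : 'M[R]_np) (P Sx : 'M[R]_n) (mux L : 'cV[R]_n).

Let Acl := A - Bu *m Zbar *m Cv.
Let M := Bw - Bu *m Zbar *m Dw.

Hypothesis Psym : P^T = P.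
Hypothesis Swsym : Sw^T = Sw.
Hypothesis P_lyapunov : Acl^T *m P *m Acl = P - Cy^T *m Cy.
Hypothesis Sx_lyapunov : Sx = Acl *m Sx *m Acl^T + M *m Sw *m M^T.
Hypothesis mux_fixed : mux = Acl *m mux + M *m muw.
Hypothesis L_fixed : (Acl - 1%:M)^T *m L = Cy^T *m (ystar - Cy *m mux).

Variable K : causal_law R n np.
Hypothesis K_measurable : measurable_law K.
Hypothesis K_bounded : forall h, forall i j, `|K h i j| <= 1.

Context d (T : measurableType d) (Pr : probability T R).
Variables (w : int -> T -> 'cV[R]_nw) (x : int -> T -> 'cV[R]_n).
Hypothesis loop : stationary_loop Pr A Bu Bw Cv Dw muw Sw K w x.
Variable k : int.

Let dZ (t : T) : 'M[R]_np := gain K x k t - Zbar.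
Let N (t : T) : 'M[R]_(n, nw) := noise_gain Bu M Dw (dZ t).
Let G : set (set T) := sigma_mx (x k) `|` sigma_mx (gain K x k).

Let x_sqint l : square_integrable Pr (x l).
Proof. exact: (loop_square_integrable loop). Qed.

Let x_measurable l : measurable_mx (x l).
Proof. exact: (square_integrable_measurable (x_sqint l)). Qed.

Let Z_measurable B : borel_mx B -> measurable (gain K x k @^-1` B).
Proof. exact: measurable_gain. Qed.

(** This bound is what keeps products of the random gain with the state integrable. *)
Let dZ_bounded : bounded_mx dZ.
Proof.
apply: (bounded_mxD _ (bounded_mx_cst _ (- Zbar))) => i j.
by exists 1 => t; exact: K_bounded.
Qed.

Let dZ_measurable : measurable_mx dZ.
Proof.
apply: measurable_mxD; last exact: measurable_mx_cst.
move=> i j _ B mB.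
by rewrite setTI; exact: (Z_measurable (borel_mx_entry i j mB)).
Qed.

(** Two notions of measurability are needed: the ambient one for integrability, and this one, with
    respect to the data at time [k], for independence from [w k]. *)
Let dZ_Gmeasurable : measurable_mx (dZ : g_sigma_algebraType G -> 'M[R]_np).
Proof.
apply: measurable_mxD; last exact: measurable_mx_cst.
by apply: sigma_mx_measurable; exact: subsetUr.
Qed.

Let x_Gmeasurable : measurable_mx (x k : g_sigma_algebraType G -> 'cV[R]_n).
Proof. by apply: sigma_mx_measurable; exact: subsetUl. Qed.

(** The source space is arbitrary so that the result serves both for the ambient sigma-algebra and
    for the one generated by [G]. *)
Let N_measurable d' (S : measurableType d') (D : S -> 'M[R]_np) :
  measurable_mx D -> measurable_mx (fun s => noise_gain Bu M Dw (D s)).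
Proof.
move=> mD; apply: measurable_mxD; first exact: measurable_mx_cst.
apply: measurable_mxN; apply: measurable_mulmx; last exact: measurable_mx_cst.
exact: (measurable_mulmx (measurable_mx_cst Bu) mD).
Qed.

Let N_bounded : bounded_mx N.
Proof.
apply: (bounded_mxD (bounded_mx_cst _ M) _); apply: bounded_mxN.
apply: (bounded_mulmx _ (bounded_mx_cst _ Dw)).
exact: (bounded_mulmx (bounded_mx_cst _ Bu) dZ_bounded).
Qed.

Let drift_measurable d' (S : measurableType d') (D : S -> 'M[R]_np)
    (y : S -> 'cV[R]_n) : measurable_mx D -> measurable_mx y ->
  measurable_mx (fun s => drift Acl Bu Cv Dw muw mux (y s) (D s)).
Proof.
move=> mD my; apply: measurable_mxD; last apply: measurable_mxN.
  apply: measurable_mulmx; first exact: measurable_mx_cst.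
  exact: (measurable_mxD my (measurable_mx_cst (- mux))).
apply: measurable_mulmx.
  exact: (measurable_mulmx (measurable_mx_cst Bu) mD).
apply: measurable_mxD; last exact: measurable_mx_cst.
exact: (measurable_mulmx (measurable_mx_cst Cv) my).
Qed.

(** The drift is affine in the square-integrable state, with bounded random coefficients. *)
Let drift_integrable :
  integrable_mx Pr (fun t => drift Acl Bu Cv Dw muw mux (x k t) (dZ t)).
Proof.
have affine (p : nat) (B : 'M[R]_(p, n)) (b : 'cV[R]_p) :
    integrable_mx Pr (fun t => B *m x k t + b).
  apply: square_integrable_mx; apply: square_integrableD.
    exact: square_integrable_mulmx.
  exact: square_integrable_cst.
apply: integrable_mxD.
  under eq_fun do rewrite mulmxBr.
  exact: affine.
apply: integrable_mxN; apply: (integrable_mulmx _ _ (affine _ Cv (Dw *m muw))).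
  exact: (measurable_mulmx (measurable_mx_cst Bu) dZ_measurable).
exact: (bounded_mulmx (bounded_mx_cst _ Bu) dZ_bounded).
Qed.

(** Half the gradient of the storage function at the predicted next state. *)
Let costate (t : T) : 'cV[R]_n :=
  P *m drift Acl Bu Cv Dw muw mux (x k t) (dZ t) + L.

Let linear_noise :
  zero_mean Pr (fun t => cvdot ((N t)^T *m costate t) (w k t - muw)).
Proof.
(* A scalar product is the trace of a matrix of size 1, the shape that [zero_mean_indep_mulmx]
   expects. *)
have -> : (fun t => cvdot ((N t)^T *m costate t) (w k t - muw))
    = (fun t => \tr (((N t)^T *m costate t)^T *m (w k t - muw))).
  by apply/funext => t; rewrite /cvdot /mxtrace big_ord1.
apply: (zero_mean_indep_mulmx (loop_causal loop (k := k))
  (H := fun t => ((N t)^T *m costate t)^T) (V := fun t => w k t - muw)).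
- apply: entrywise_tr; apply: measurable_mulmx.
    exact: entrywise_tr (N_measurable dZ_Gmeasurable).
  apply: measurable_mxD; last exact: measurable_mx_cst.
  apply: measurable_mulmx; first exact: measurable_mx_cst.
  exact: drift_measurable.
- apply: entrywise_tr; apply: integrable_mulmx.
  + exact: entrywise_tr (N_measurable dZ_measurable).
  + exact: entrywise_tr.
  + apply: (integrable_mxD _ (integrable_mx_cst _ L)).
    apply: (integrable_mulmx _ _ drift_integrable).
      exact: measurable_mx_cst.
    exact: bounded_mx_cst.
- exact: (zero_mean_noise (loop_disturbance loop) k).
- move=> i j B mB.
  apply: (sigma_mx_comp (w k) (f := fun v => (v - muw) i j) _ mB).
  have mv := @measurable_mx_id R nw 1.
  exact: (measurable_mxD mv (measurable_mx_cst (- muw)) i j).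
Qed.

(** The coefficient is bounded and determined by the gain at time [k], hence independent of the
    centred outer product of the disturbance. *)
Let quadratic_noise :
  zero_mean Pr (fun t => \tr ((N t)^T *m P *m N t
                              *m ((w k t - muw) *m (w k t - muw)^T - Sw))).
Proof.
have quad_measurable d' (S : measurableType d') (D : S -> 'M[R]_np) :
    measurable_mx D -> measurable_mx (fun s =>
      (noise_gain Bu M Dw (D s))^T *m P *m noise_gain Bu M Dw (D s)).
  move=> mD; apply: measurable_mulmx; last exact: N_measurable.
  apply: measurable_mulmx; last exact: measurable_mx_cst.
  exact: entrywise_tr (N_measurable mD).
apply: (zero_mean_indep_mulmx (loop_causal loop (k := k))
  (H := fun t => (N t)^T *m P *m N t)
  (V := fun t => (w k t - muw) *m (w k t - muw)^T - Sw)).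
- exact: quad_measurable.
- apply: bounded_integrable_mx; first exact: quad_measurable.
  apply: (bounded_mulmx _ N_bounded).
  apply: (bounded_mulmx _ (bounded_mx_cst _ P)).
  exact: entrywise_tr.
- exact: (zero_mean_noise_sqr (loop_disturbance loop) k).
- move=> i j B mB.
  apply: (sigma_mx_comp (w k)
    (f := fun v => ((v - muw) *m (v - muw)^T - Sw) i j) _ mB).
  have mv := measurable_mxD (@measurable_mx_id R _ 1) (measurable_mx_cst (- muw)).
  apply: (measurable_mxD _ (measurable_mx_cst (- Sw)) i j).
  by apply: measurable_mulmx; [exact: mv|exact: entrywise_tr mv].
Qed.

(** The storage is quadratic, so square integrability of the state makes each of the two terms
    integrable; stationarity then equates their means. *)
Let storage_difference :
  zero_mean Pr (fun t =>
    storage P mux L (x k t) - storage P mux L (x (k + 1) t)).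
Proof.
have V1 l : (storage P mux L \o x l) \in Lfun Pr 1.
  have sm : square_integrable Pr (fun t => x l t - mux).
    exact: (square_integrableD (x_sqint l) (square_integrable_cst _ (- mux))).
  have V2 : (fun t => cvdot (x l t - mux) (P *m (x l t - mux))) \in Lfun Pr 1.
    exact: (Lfun1_cvdot sm (square_integrable_mulmx P sm)).
  have VL := Lfun1_cvdot (square_integrable_cst Pr L) sm.
  have VL2 := Lfun_scale 2 (lexx 1) VL.
  have -> : storage P mux L \o x l =
      (fun t => cvdot (x l t - mux) (P *m (x l t - mux))
                + cvdot L (x l t - mux) * 2).
    by apply/funext => t; rewrite /= /storage [2 * _]mulrC.
  exact: rpredD V2 VL2.
apply: (stationary_zero_mean (loop_stationary loop) _ (V1 k) (V1 (k + 1))).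
have mv := measurable_mxD (@measurable_mx_id R _ 1) (measurable_mx_cst (- mux)).
apply: measurable_funD.
  exact: (measurable_cvdot mv (measurable_mulmx (measurable_mx_cst P) mv)).
apply: measurable_funM; first exact: measurable_cst.
exact: (measurable_cvdot (measurable_mx_cst L) mv).
Qed.

Lemma stationary_cost :
  ('E_Pr[fun t => sqnorm2 (Cy *m x k t - ystar)%R]
   = (static_cost Sx Cy ystar mux)%:E
     + 'E_Pr[fun t => excess_cost Acl P Bu M Cv Dw Sw muw mux L
                        (x k t) (gain K x k t - Zbar)%R])%E.
Proof.
set cost := fun t => sqnorm2 _.
set excess := fun t => excess_cost _ _ _ _ _ _ _ _ _ _ _ _.
set Jbar := static_cost _ _ _ _.
pose rest t := (storage P mux L (x k t) - storage P mux L (x (k + 1) t))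
    + 2 * cvdot ((N t)^T *m costate t) (w k t - muw)
    + \tr ((N t)^T *m P *m N t *m ((w k t - muw) *m (w k t - muw)^T - Sw)).
have [rest1 rest0] : zero_mean Pr rest.
  apply: (zero_meanD _ quadratic_noise).
  apply: (zero_meanD storage_difference _).
  exact: (zero_meanZ 2 linear_noise).
have cost1 : cost \in Lfun Pr 1.
  rewrite /cost; under eq_fun do rewrite sqnorm2_cvdot.
  have sy : square_integrable Pr (fun t => Cy *m x k t - ystar).
    apply: square_integrableD; last exact: square_integrable_cst.
    exact: square_integrable_mulmx.
  exact: (Lfun1_cvdot sy sy).
(* Solving the pathwise identity for [excess] expresses it through functions already known to be
   integrable. *)
have -> : excess = cost \- (cst Jbar \+ rest).
  apply/funext => t /=; rewrite /cost.
  rewrite (@storage_increment _ _ _ _ _ Acl P Sx Bu M Cv Dw Cy Sw muw ystar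
    mux L _ _ _ _ _ _ (x k t) (w k t) (dZ t) (x (k + 1) t)) //.
    by rewrite /excess /rest -/Jbar /costate /N /dZ; ring.
  rewrite (loop_dynamics loop) /= /Acl /M /dZ.
  rewrite mulmxN !(mulmxBl, mulmxBr, mulmxDl, mulmxDr) !mulmxA.
  by apply/matrixP => i j; rewrite !mxE; ring.
have J1 : cst Jbar \in Lfun Pr 1 by exact: Lfun_cst.
have c1 : cst Jbar \+ rest \in Lfun Pr 1 by exact: rpredD.
rewrite (expectationB cost1 c1) (expectationD J1 rest1) rest0 adde0.
by rewrite expectation_cst [RHS]addeC subeK.
Qed.

End ClosedLoopCost.

(** * Deriving the assumptions of the cost formula from those of the theorem *)

Unset Implicit Arguments.

Theorem theorem1 (R : realType) (n np ny nw : nat)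
    (* plant *)
    (A : 'M[R]_n) (Bu : 'M[R]_(n, np)) (Bw : 'M[R]_(n, nw))
    (Cv : 'M[R]_(np, n)) (Du : 'M[R]_np) (Dw : 'M[R]_(np, nw))
    (Cy : 'M[R]_(ny, n))
    (muw : 'cV[R]_nw) (Sw : 'M[R]_nw) (ystar : 'cV[R]_ny)
    (hSw : pdmx Sw) (hpass : passive A Bu Cv Du)
    (* static control *)
    (Zbar : 'M[R]_np) (hZbar : feasible Du Zbar)
    (P : 'M[R]_n) (hPpsd : psdmx P)
    (hP : unique (fun X : 'M[R]_n =>
        0 = (A - Bu *m Zbar *m Cv)^T *m X *m (A - Bu *m Zbar *m Cv)
            - X + Cy^T *m Cy) P)
    (Sx : 'M[R]_n) (hSxpsd : psdmx Sx)
    (hSx : Sx = (A - Bu *m Zbar *m Cv) *m Sx *m (A - Bu *m Zbar *m Cv)^T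
                + (Bw - Bu *m Zbar *m Dw) *m Sw *m (Bw - Bu *m Zbar *m Dw)^T)
    (* dynamic control *)
    (K : causal_law R n np) (hKmeas : measurable_law K)
    (hKfeas : forall h : nat -> 'cV[R]_n, feasible Du (K h))
    (d : measure_display) (T : measurableType d) (Pr : probability T R)
    (w : int -> T -> 'cV[R]_nw) (x : int -> T -> 'cV[R]_n)
    (hloop : stationary_loop Pr A Bu Bw Cv Dw muw Sw K w x) :
  let Acl := A - Bu *m Zbar *m Cv in
  let mux := invmx (1%:M - A + Bu *m Zbar *m Cv)
               *m (Bw - Bu *m Zbar *m Dw) *m muw in
  let Jbar := \tr (Cy *m Sx *m Cy^T) + sqnorm2 (Cy *m mux - ystar) in
  let L := (invmx (Acl - 1%:M))^T *m Cy^T *m (ystar - Cy *m mux) in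
  let F := Bu^T *m P *m Acl in
  let Rm := Bu^T *m P *m Bu in
  let M := Bw - Bu *m Zbar *m Dw in
  let G := Bu^T *m P *m M *m Sw *m Dw^T in
  let W := Dw *m Sw *m Dw^T in
  let phi := fun (xk : 'cV[R]_n) (Zk : 'M[R]_np) =>
    let m := xk - mux in
    let r := F *m m + Bu^T *m L in
    let q := Cv *m xk + Dw *m muw in
    let dZ := Zk - Zbar in
    (q^T *m dZ^T *m Rm *m dZ *m q) 0 0 - 2 * (r^T *m dZ *m q) 0 0
    + \tr (W *m dZ^T *m Rm *m dZ - 2 *: (G^T *m dZ)) in
  (* Jbar is the stationary performance with the gain held at Zbar *)
  (forall (d0 : measure_display) (T0 : measurableType d0)
     (Pr0 : probability T0 R)
     (w0 : int -> T0 -> 'cV[R]_nw) (x0 : int -> T0 -> 'cV[R]_n),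
     stationary_loop Pr0 A Bu Bw Cv Dw muw Sw (fun=> Zbar) w0 x0 ->
     forall k : int,
       ('E_Pr0[fun t => sqnorm2 (Cy *m x0 k t - ystar)%R] = Jbar%:E)%E) /\
  (forall k : int,
     ('E_Pr[fun t => sqnorm2 (Cy *m x k t - ystar)%R]
      = Jbar%:E + 'E_Pr[fun t => phi (x k t) (gain K x k t)])%E).
Proof.
move=> Acl mux Jbar L F Rm M G W phi.
have Psym : P^T = P by case: hPpsd.
have Swsym : Sw^T = Sw by case: hSw.
have P_lyapunov : Acl^T *m P *m Acl = P - Cy^T *m Cy.
  have [/esym/eqP] := hP; rewrite -addrA addr_eq0 opprD opprK => /eqP Peq _.
  exact: Peq.
(* Invertibility comes from uniqueness of [P]; it makes both [invmx] in the statement genuine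
   inverses. *)
have Acl1 : (1%:M - Acl) \in unitmx by exact: lyapunov_unique_unitmx hP.
have AclE : 1%:M - A + Bu *m Zbar *m Cv = 1%:M - Acl.
  by rewrite /Acl opprB addrA addrAC.
have mux_fixed : mux = Acl *m mux + M *m muw.
  have : (1%:M - Acl) *m mux = M *m muw by rewrite /mux AclE -mulmxA mulKVmx.
  by rewrite mulmxBl mul1mx => <-; rewrite addrC subrK.
have L_fixed : (Acl - 1%:M)^T *m L = Cy^T *m (ystar - Cy *m mux).
  rewrite /L trmx_inv !mulmxA mulmxV ?mul1mx// unitmx_tr -opprB.
  by rewrite -scaleN1r unitmxZ ?unitrN1.
(* The law is still free here, so the formula applies both to [K] and to the constant gain
   [Zbar]. *)
have cost := stationary_cost Psym Swsym P_lyapunov hSx mux_fixed L_fixed.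
have bounded Z : feasible Du Z -> forall i j, `|Z i j| <= 1.
  exact: (feasible_bounded (passive_Du hpass)).
split=> [d0 T0 Pr0 w0 x0 hloop0 k|k]; last first.
  exact: (cost K hKmeas (fun h => bounded _ (hKfeas h)) d T Pr w x hloop k).
(* Preimages under a constant law are empty or everything; the latter is obtained as the complement
   of the empty set. *)
have mcst : measurable_law ((fun=> Zbar) : causal_law R n np).
  move=> B _; set H := (X in <<s X >>).
  have [H0 HC _] := smallest_sigma_algebra setT H.
  have [ZB|ZB] := pselect (B Zbar).
    rewrite (_ : _ @^-1` _ = setT `\` set0); first exact: HC.
    by rewrite setD0 -subTset => h _.
  by rewrite (_ : _ @^-1` _ = set0)// -subset0 => h.
rewrite (cost _ mcst (fun=> bounded _ hZbar) d0 T0 Pr0 w0 x0 hloop0 k).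
rewrite [X in (_ + 'E_Pr0[X])%E](_ : _ = cst 0); last first.
  apply/funext => t; rewrite /gain subrr /excess_cost !(trmx0, mulmx0, mul0mx).
  by rewrite mxE scaler0 subrr mxtrace0 mulr0 subrr addr0.
by rewrite expectation_cst adde0.
Qed.
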